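(* Let $(G,\alpha)$ be a Hom-group and let $H$, $K$ be two Hom-subgroups of $G$. Then: (1) $H\cap K$ is a Hom-subgroup of $G$; (2) $H\cup K$ is a Hom-subgroup of $G$ if and only if $H\subseteq K$ or $K\subseteq H$.
   Context: A Hom-group $(G,\alpha)$ is a set $G$ together with a distinguished element $1\in G$ (the unit), a bijective map $\alpha:G\to G$ and a binary operation $G\times G\to G$, $(g,h)\mapsto gh$, such that for all $g,h,k\in G$: (1) $\alpha(g)(hk)=(gh)\alpha(k)$; (2) $\alpha(gh)=\alpha(g)\alpha(h)$; (3) $g1=1g=\alpha(g)$; (4) there exists $g^{-1}\in G$ with $gg^{-1}=g^{-1}g=1$. A Hom-subgroup of a Hom-group $(G,\alpha)$ is a nonempty subset $H\subseteq G$ closed under the product of $G$ such that $(H,\alpha)$ (with $\alpha$ restricted to a bijection $H\to H$) is itself a Hom-group under the product of $G$. *)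

(* Defs.v *)
From mathcomp Require Import all_boot.
From mathcomp Require Import boolp classical_sets functions.
Set Implicit Arguments.
Unset Strict Implicit.
Unset Printing Implicit Defensive.
Local Open Scope classical_set_scope.

(* The axioms are relative to a carrier A, so that the same predicate applies
   to a whole type (A = [set: G]) and to a subset with the restricted product
   and twisting map. *)
Record is_hom_group (T : Type) (A : set T) (mul : T -> T -> T)
    (alpha : T -> T) (one : T) : Prop := IsHomGroup {
  hom_one_in : A one;
  hom_mul_in : forall g h, A g -> A h -> A (mul g h);
  hom_alpha_bij : set_bij A A alpha;
  hom_assoc : forall g h k, A g -> A h -> A k ->
    mul (alpha g) (mul h k) = mul (mul g h) (alpha k);
  hom_alphaM : forall g h, A g -> A h ->
    alpha (mul g h) = mul (alpha g) (alpha h);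
  hom_unit : forall g, A g -> mul g one = alpha g /\ mul one g = alpha g;
  hom_inv : forall g, A g ->
    exists2 g', A g' & mul g g' = one /\ mul g' g = one
}.

(* The unit of H is not required to be that of the ambient Hom-group. *)
Definition is_hom_subgroup (G : Type) (mul : G -> G -> G) (alpha : G -> G)
    (H : set G) : Prop :=
  [/\ H !=set0,
      forall g h, H g -> H h -> H (mul g h) &
      exists e, is_hom_group H mul alpha e].

(* Main.v *)
Require Import Defs.
From mathcomp Require Import all_boot.
From mathcomp Require Import boolp classical_sets functions.
Local Open Scope classical_set_scope.

(** The twisted associativity gives [alpha (g^-1) (g h) = alpha (alpha h)] and
    [(g h) alpha (h^-1) = alpha (alpha g)]; since [alpha] is injective, one may
    cancel as in a group.  Cancellation forces the unit of a Hom-subgroup to be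
    the ambient one ([hom_subgroup_unit]).  The same two identities show that a
    Hom-subgroup containing a product and one of its factors contains
    [alpha (alpha x)] for the other factor [x], hence [x] itself
    ([hom_mem_rfactor], [hom_mem_lfactor]).

    Both claims follow.  If [g] lies in [H] and [K], its inverse chosen in [H]
    is a factor of the common unit, whose other factor [g] is in [K], so that
    inverse is in [K] too; this settles the intersection.  For the union, take
    [h] in [H] but not in [K] and any [k] in [K]: the product [h k] cannot lie
    in [K], so it lies in [H], and hence so does [k]. *)

Section HomGroup.
Context {G : Type} {mul : G -> G -> G} {alpha : G -> G} {one : G}.
Hypothesis hG : is_hom_group [set: G] mul alpha one.

Lemma hom_alpha_inj : injective alpha.
Proof.
by case: (hom_alpha_bij hG) => _ + _ x y; apply; rewrite inE.
Qed.

Lemma hom_mulKl {g g'} h : mul g' g = one ->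
  mul (alpha g') (mul g h) = alpha (alpha h).
Proof.
move=> g'g; rewrite (hom_assoc hG) // g'g.
by have [] := hom_unit hG (g := alpha h) I.
Qed.

Lemma hom_mulKr {h h'} g : mul h h' = one ->
  mul (mul g h) (alpha h') = alpha (alpha g).
Proof.
move=> hh'; rewrite -(hom_assoc hG) // hh'.
by have [] := hom_unit hG (g := alpha g) I.
Qed.

Lemma hom_mul_injr g : injective (mul g).
Proof.
move=> h k ghk; have [g' _ [_ g'g]] := hom_inv hG (g := g) I.
by do 2 apply: hom_alpha_inj; rewrite -!(hom_mulKl _ g'g) ghk.
Qed.

(** A unit [e] of [H] satisfies [e e = alpha e = e 1], so [e] cancels. *)
Lemma hom_subgroup_unit {H : set G} :
  is_hom_subgroup mul alpha H -> is_hom_group H mul alpha one.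
Proof.
move=> [_ _ [e hH]]; suff <- : e = one by [].
apply: (@hom_mul_injr e).
have [-> _] := hom_unit hH (hom_one_in hH).
by have [-> _] := hom_unit hG (g := e) I.
Qed.

Lemma hom_group_subgroup {H : set G} :
  is_hom_group H mul alpha one -> is_hom_subgroup mul alpha H.
Proof.
move=> hH; split; [by exists one; exact: hom_one_in hH | | by exists one].
exact: hom_mul_in hH.
Qed.

Section Membership.
Context {H : set G}.
Hypothesis hH : is_hom_group H mul alpha one.

Lemma hom_mem_alpha x : H x -> H (alpha x).
Proof. by have [Hfun _ _] := hom_alpha_bij hH; exact: Hfun. Qed.

(** The preimage of [alpha x] found in [H] must be [x] itself, by injectivity
    of [alpha] on all of [G]. *)
Lemma hom_alpha_mem x : H (alpha x) -> H x.
Proof.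
by have [_ _ Hsurj] := hom_alpha_bij hH; move=> /Hsurj [y Hy /hom_alpha_inj <-].
Qed.

(** Multiplying [g h] by [alpha (g^-1)] on the left, inside [H], leaves
    [alpha (alpha h)]. *)
Lemma hom_mem_rfactor g h : H g -> H (mul g h) -> H h.
Proof.
move=> Hg Hgh; have [g' Hg' [_ g'g]] := hom_inv hH Hg.
do 2 apply: hom_alpha_mem; rewrite -(hom_mulKl _ g'g).
by apply: (hom_mul_in hH) => //; exact: hom_mem_alpha.
Qed.

Lemma hom_mem_lfactor g h : H h -> H (mul g h) -> H g.
Proof.
move=> Hh Hgh; have [h' Hh' [hh' _]] := hom_inv hH Hh.
do 2 apply: hom_alpha_mem; rewrite -(hom_mulKr _ hh').
by apply: (hom_mul_in hH) => //; exact: hom_mem_alpha.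
Qed.

End Membership.

Lemma hom_groupI {H K : set G} :
  is_hom_group H mul alpha one -> is_hom_group K mul alpha one ->
  is_hom_group (H `&` K) mul alpha one.
Proof.
move=> hH hK; split.
- by split; [exact: hom_one_in hH | exact: hom_one_in hK].
- move=> g h [Hg Kg] [Hh Kh].
  by split; [exact: (hom_mul_in hH) | exact: (hom_mul_in hK)].
- split=> [x [Hx Kx]|x y _ _|x [Hx Kx]].
  + by split; [exact: (hom_mem_alpha hH) | exact: (hom_mem_alpha hK)].
  + exact: hom_alpha_inj.
  + have [_ _ /(_ x I) [y _ yx]] := hom_alpha_bij hG.
    exists y => //; rewrite -yx in Hx Kx.
    by split; [exact: (hom_alpha_mem hH) | exact: (hom_alpha_mem hK)].
- by move=> g h k _ _ _; exact: (hom_assoc hG).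
- by move=> g h _ _; exact: (hom_alphaM hG).
- by move=> g _; exact: (hom_unit hG).
- move=> g [Hg Kg]; have [g' Hg' [gg' g'g]] := hom_inv hH Hg.
  exists g' => //; split=> //.
  (* The product g g' = 1 lies in K, and so does its factor g. *)
  by apply: (hom_mem_rfactor hK g) => //; rewrite gg'; exact: hom_one_in hK.
Qed.

Lemma hom_groupU_sub {H K : set G} :
  is_hom_group H mul alpha one -> is_hom_group K mul alpha one ->
  (forall g h, (H `|` K) g -> (H `|` K) h -> (H `|` K) (mul g h)) ->
  H `<=` K \/ K `<=` H.
Proof.
move=> hH hK UM.
have [HK|/existsNP [h /not_implyP [Hh nKh]]] := pselect (H `<=` K).
  by left.
right=> k Kk; have [Hhk|Khk] := UM h k (or_introl Hh) (or_intror Kk).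
  exact: hom_mem_rfactor Hhk.
by case: nKh; exact: hom_mem_lfactor Khk.
Qed.

End HomGroup.

Theorem theorem3p10 (G : Type) (mul : G -> G -> G) (alpha : G -> G) (one : G)
    (hG : is_hom_group [set: G] mul alpha one) (H K : set G)
    (hH : is_hom_subgroup mul alpha H) (hK : is_hom_subgroup mul alpha K) :
  is_hom_subgroup mul alpha (H `&` K) /\
  (is_hom_subgroup mul alpha (H `|` K) <-> H `<=` K \/ K `<=` H).
Proof.
have gH := hom_subgroup_unit hG hH; have gK := hom_subgroup_unit hG hK.
split; first exact: hom_group_subgroup (hom_groupI hG gH gK).
split=> [[_ UM _]|]; first exact: (hom_groupU_sub hG gH gK UM).
by case=> [/setUidPr|/setUidPl] ->.
Qed.
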